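(* Let $V=\bigoplus_{n=0}^{\infty}V_{(n)}$ be an $\mathbb{N}$-graded vertex algebra over $\mathbb{C}$ such that: (a) $2\leq \dim V_{(0)}<\infty$, $1\leq \dim V_{(1)}<\infty$, and $V$ is generated (as a vertex algebra) by $V_{(0)}$ and $V_{(1)}$; (b) $V_{(0)}$ is not a trivial module of the Leibniz algebra $V_{(1)}$, and $u_0u\neq 0$ for some $u\in V_{(1)}$; (c) the Levi factor of $V_{(1)}$ equals $\mathrm{Span}\{e,f,h\}$, with $e_0f=h$, $h_0e=2e$, $h_0f=-2f$ and $e_1f=k\mathbf{1}$, where $k\in\mathbb{C}\setminus\{0\}$. Assume that one of the following statements holds: (i) $V_{(1)}$ is a simple Leibniz algebra; (ii) $V_{(1)}$ is a semisimple Leibniz algebra and $\mathrm{Ker}(D)\cap V_{(0)}=\{a\in V_{(0)}\mid b_0a=0\text{ for all } b\in V_{(1)}\}$, where $D$ is the linear operator on $V$ with $D(v)=v_{-2}\mathbf{1}$ for $v\in V$. Then $V$ is indecomposable but not a simple vertex algebra.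
   Context: All vector spaces are over $\mathbb{C}$; $\mathbb{N}=\{0,1,2,\dots\}$. A vertex algebra is a vector space $V$ with a linear map $Y:V\to \mathrm{End}(V)[[x,x^{-1}]]$, $v\mapsto Y(v,x)=\sum_{n\in\mathbb{Z}}v_nx^{-n-1}$, and a vacuum vector $\mathbf{1}$ such that for all $u,v\in V$: $u_nv=0$ for $n$ sufficiently large; $Y(\mathbf{1},x)=1$; $Y(v,x)\mathbf{1}\in V[[x]]$ and $\lim_{x\to0}Y(v,x)\mathbf{1}=v$; and the Jacobi identity holds: $x_0^{-1}\delta\left(\frac{x_1-x_2}{x_0}\right)Y(u,x_1)Y(v,x_2)-x_0^{-1}\delta\left(\frac{x_2-x_1}{-x_0}\right)Y(v,x_2)Y(u,x_1)=x_2^{-1}\delta\left(\frac{x_1-x_0}{x_2}\right)Y(Y(u,x_0)v,x_2)$. $V$ is $\mathbb{N}$-graded if $V=\bigoplus_{n\in\mathbb{N}}V_{(n)}$, $\mathbf{1}\in V_{(0)}$, and $u_mV_{(n)}\subseteq V_{(k+n-m-1)}$ for $u\in V_{(k)}$, $m\in\mathbb{Z}$ (with $V_{(j)}=0$ for $j<0$). $V$ is generated by a subset $S$ if the smallest vertex subalgebra containing $S$ is $V$. An ideal of $V$ is a subspace $I$ with $v_nw\in I$ and $w_nv\in I$ for all $v\in V$, $w\in I$, $n\in\mathbb{Z}$. $V$ is simple if its only ideals are $0$ and $V$; $V$ is decomposable if $V=U\oplus W$ for nonzero proper ideals $U,W$, and indecomposable otherwise. A (left) Leibniz algebra is a vector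 space $\mathfrak{L}$ with a bilinear bracket satisfying $[a,[b,c]]=[[a,b],c]+[b,[a,c]]$. An ideal is a subspace $I$ with $[\mathfrak{L},I]\subseteq I$ and $[I,\mathfrak{L}]\subseteq I$. $\mathrm{Leib}(\mathfrak{L})=\mathrm{Span}\{[u,u]\mid u\in\mathfrak{L}\}$ is an ideal. $\mathfrak L$ is solvable if its derived series ($\mathfrak{L}^{(1)}=[\mathfrak{L},\mathfrak{L}]$, $\mathfrak{L}^{(i+1)}=[\mathfrak{L}^{(i)},\mathfrak{L}^{(i)}]$) reaches $0$; $\mathrm{rad}(\mathfrak{L})$ is the unique maximal solvable ideal. $\mathfrak{L}$ is simple if $[\mathfrak{L},\mathfrak{L}]\neq \mathrm{Leib}(\mathfrak{L})$ and $0$, $\mathrm{Leib}(\mathfrak{L})$, $\mathfrak{L}$ are its only ideals; it is semisimple if $\mathrm{rad}(\mathfrak{L})=\mathrm{Leib}(\mathfrak{L})$. A Levi factor of $\mathfrak{L}$ is a subalgebra $S$ that is a semisimple Lie algebra with $\mathfrak{L}=S\dot{+}\mathrm{rad}(\mathfrak{L})$ (direct sum of vector spaces); in (c) the Levi factor is isomorphic to $sl_2$ with the usual basis $e,f,h$. For an $\mathbb{N}$-graded vertex algebra $V$, $V_{(1)}$ is a Leibniz algebra with bracket $[u,v]=u_0v$, and $V_{(0)}$ is a $V_{(1)}$-module via $u\cdot a=u_0a$; it is a trivial module if $u_0a=0$ for all $u\in V_{(1)}$, $a\in V_{(0)}$. *)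

(* Defs.v *)
From HB Require Import structures.
From mathcomp Require Import all_boot all_order all_algebra.
From mathcomp Require Export complex.
From mathcomp Require Import boolp classical_sets functions cardinality fsbigop.
From mathcomp Require Export reals.

Set Implicit Arguments.
Unset Strict Implicit.
Unset Printing Implicit Defensive.

Import Order.TTheory GRing.Theory Num.Theory.

Local Open Scope classical_set_scope.
Local Open Scope ring_scope.

Section Subspaces.
Context {K : numFieldType} {V : lmodType K}.
Implicit Types A B L S : set V.

Definition subspace A := GRing.submod_closed [in A].

Definition lspan S : set V := smallest subspace S.

Definition has_dim A (d : nat) :=
  exists2 b : 'I_d -> V,
    forall c : 'I_d -> K, \sum_i c i *: b i = 0 -> forall i, c i = 0
  & A = [set v | exists c : 'I_d -> K, v = \sum_i c i *: b i].

Definition direct_sum L A B :=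
  L = [set a + b | a in A & b in B] /\ A `&` B = [set 0].

End Subspaces.

(* Leibniz algebras are carried by subspaces L of an ambient space; br is the  *)
(* bracket, and its values outside L are irrelevant.                           *)
Section Leibniz.
Context {K : numFieldType} {V : lmodType K}.
Variable br : V -> V -> V.
Implicit Types L I J S : set V.

Record leibniz_algebra L : Prop := LeibnizAlgebra {
  leib_subspace : subspace L;
  leib_closed : forall a b, L a -> L b -> L (br a b);
  leib_linearl : forall c a a' b, L a -> L a' -> L b ->
    br (c *: a + a') b = c *: br a b + br a' b;
  leib_linearr : forall c a b b', L a -> L b -> L b' ->
    br a (c *: b + b') = c *: br a b + br a b';
  leib_identity : forall a b c, L a -> L b -> L c ->
    br a (br b c) = br (br a b) c + br b (br a c) }.

Definition lie_algebra L :=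
  leibniz_algebra L /\ forall a, L a -> br a a = 0.

Definition leibniz_ideal L I :=
  [/\ subspace I, I `<=` L &
      forall a x, L a -> I x -> I (br a x) /\ I (br x a)].

Definition Leib L : set V := lspan [set br u u | u in L].

Definition bracket I J : set V := lspan [set br a b | a in I & b in J].

Definition leibniz_derived L (i : nat) : set V := iter i (fun I => bracket I I) L.

Definition leibniz_solvable L := exists i, leibniz_derived L i = [set 0].

Definition maximal_solvable_ideal L J :=
  [/\ leibniz_ideal L J, leibniz_solvable J &
      forall I, leibniz_ideal L I -> leibniz_solvable I -> J `<=` I -> I = J].

Definition is_radical L J :=
  forall I, maximal_solvable_ideal L I <-> I = J.

Definition leibniz_simple L :=
  bracket L L <> Leib L /\
  forall I, leibniz_ideal L I -> [\/ I = [set 0], I = Leib L | I = L].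

Definition leibniz_semisimple L := is_radical L (Leib L).

Definition levi_factor L S :=
  [/\ S `<=` L, lie_algebra S, leibniz_semisimple S &
      exists2 J, is_radical L J & direct_sum L S J].

End Leibniz.

Section FormalCalculus.
Context {K : numFieldType}.

Definition zbinom (n : int) (i : nat) : K :=
  (\prod_(j < i) (n%:~R - j%:R)) / i`!%:R.

(* A series in x0, x1, x2 is given by its coefficients: f a b c is the         *)
(* coefficient of x0^a x1^b x2^c.                                              *)
Definition series3 (M : Type) := int -> int -> int -> M.

(* Coefficient of z^r x^s y^t in                                               *)
(*   z^-1 delta((x - y) / z) = \sum_(n in Z) z^(- n - 1) (x - y)^n,            *)
(* where (x - y)^n is expanded in nonnegative powers of y.                     *)
Definition delta_coef (r s t : int) : K :=
  if t is Posz i then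
    if r + s + t == -1 then (-1) ^+ i * zbinom (- r - 1) i else 0
  else 0.

(* x0^-1 delta((x1 - x2) / x0) *)
Definition delta_x0 : series3 K := fun a b c => delta_coef a b c.

(* x0^-1 delta((x2 - x1) / (- x0)): the substitution z = - x0 multiplies the   *)
(* coefficient of x0^a by (-1)^a, and x0^-1 = - z^-1.                          *)
Definition delta_Nx0 : series3 K := fun a b c =>
  (-1) ^ (a + 1) * delta_coef a c b.

(* x2^-1 delta((x1 - x0) / x2) *)
Definition delta_x2 : series3 K := fun a b c => delta_coef c b a.

(* The Cauchy product. The sum ranges over all of Z^3 and is by convention 0   *)
(* when infinitely many terms are nonzero; this does not happen in the Jacobi  *)
(* identity below, by the truncation axiom.                                    *)
Definition mul3 (V : lmodType K) (k : series3 K) (F : series3 V) : series3 V :=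
  fun a b c => \sum_(p \in [set: int * int * int])
    k p.1.1 p.1.2 p.2 *: F (a - p.1.1) (b - p.1.2) (c - p.2).

End FormalCalculus.

(* mode u n v is u_n v, where Y(u, x) = \sum_(n in Z) u_n x^(- n - 1).         *)
Record vertex_algebra {K : numFieldType} (V : lmodType K) := VertexAlgebra {
  mode : V -> int -> V -> V;
  vacuum : V;
  mode_linearl : forall n v, linear (fun u => mode u n v);
  mode_linearr : forall u n, linear (mode u n);
  truncation : forall u v, exists N : int, forall n, N <= n -> mode u n v = 0;
  vacuum_mode : forall n v, mode vacuum n v = if n == -1 then v else 0;
  creation_regular : forall v (n : int), 0 <= n -> mode v n vacuum = 0;
  creation : forall v, mode v (-1) vacuum = v;
  jacobi : forall u v w a b c,
    mul3 delta_x0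
      (* Y(u, x1) Y(v, x2) w *)
      (fun i j l => if i == 0 then mode u (- j - 1) (mode v (- l - 1) w) else 0)
      a b c
    - mul3 delta_Nx0
      (* Y(v, x2) Y(u, x1) w *)
      (fun i j l => if i == 0 then mode v (- l - 1) (mode u (- j - 1) w) else 0)
      a b c
    = mul3 delta_x2
      (* Y(Y(u, x0) v, x2) w *)
      (fun i j l => if j == 0 then mode (mode u (- i - 1) v) (- l - 1) w else 0)
      a b c }.

Section VertexAlgebras.
Context {K : numFieldType} {V : lmodType K}.
Variable A : vertex_algebra V.

Definition D (v : V) : V := mode A v (-2) (vacuum A).

Definition zgraded_part (G : nat -> set V) (j : int) : set V :=
  if j is Posz n then G n else [set 0].

Record N_grading (G : nat -> set V) : Prop := NGrading {
  grading_subspace : forall n, subspace (G n);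
  grading_sum : forall v, exists N (x : nat -> V),
    (forall n, G n (x n)) /\ v = \sum_(n < N) x n;
  grading_direct : forall N (x : nat -> V), (forall n, G n (x n)) ->
    \sum_(n < N) x n = 0 -> forall n, (n < N)%N -> x n = 0;
  grading_vacuum : G 0%N (vacuum A);
  grading_mode : forall (k n : nat) (m : int) u v, G k u -> G n v ->
    zgraded_part G (k%:Z + n%:Z - m - 1) (mode A u m v) }.

Definition vertex_subalgebra (B : set V) :=
  [/\ subspace B, B (vacuum A) &
      forall u v n, B u -> B v -> B (mode A u n v)].

Definition generated_by (S : set V) := smallest vertex_subalgebra S = setT.

Definition va_ideal (I : set V) :=
  subspace I /\
  forall v w n, I w -> I (mode A v n w) /\ I (mode A w n v).

Definition va_simple := forall I, va_ideal I -> I = [set 0] \/ I = setT.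

Definition decomposable := exists U W,
  [/\ va_ideal U /\ va_ideal W, U <> [set 0] /\ U <> setT,
      W <> [set 0] /\ W <> setT & direct_sum setT U W].

Definition indecomposable := ~ decomposable.

Definition bracket0 (u v : V) : V := mode A u 0 v.

Definition trivial_module (L M : set V) :=
  forall u a, L u -> M a -> mode A u 0 a = 0.

End VertexAlgebras.

(* Main.v *)
Require Import Defs.
From mathcomp Require Import all_boot all_order all_algebra classical_sets.
From mathcomp Require Import boolp fsbigop.
From mathcomp Require Import zify ring.

(* Not simple. On the finite-dimensional commutative algebra V_(0) let m be    *)
(* the radical of the trace form tr (L_x L_y), where L_x is multiplication by  *)
(* x. It contains every u_0 a with u in V_(1): these are values of derivations *)
(* d, L_(d a) = [d, L_a], and tr ([d, L_a] L_y) = tr (d [L_a, L_y]) = 0. So m  *)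
(* is nonzero and stable under V_(1), while tr 1 = dim V_(0) keeps the vacuum  *)
(* out of m. The vectors that no product of modes of V_(0) and V_(1) moves out *)
(* of m in degree 0 form an ideal which contains m but not the vacuum.         *)
(*                                                                             *)
(* Indecomposable. A decomposition of V into ideals yields an idempotent p of  *)
(* V_(0) with D p = 0, and then P = p_(-1) commutes with all modes. If P e = 0 *)
(* then k p = (P e)_1 f = 0. In case (i), P V_(1) and (1 - P) V_(1) are        *)
(* Leibniz ideals with intersection 0, hence one of them vanishes, for Leib is *)
(* nonzero. In case (ii), P e is an eigenvector of h_0, so it lies in          *)
(* a e + Leib for some scalar a, and P (P e) = P e forces P e or (1 - P) e     *)
(* into Leib. If P e is in Leib, so are P h and P f; since Leib is contained   *)
(* in D V_(0), whose elements act by 0, V_(1) acts trivially on P V_(0); thus  *)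
(* D P V_(0) = 0 and P e, which is in P D V_(0), is 0.                         *)

Set Implicit Arguments.
Unset Strict Implicit.
Unset Printing Implicit Defensive.

Import Order.TTheory GRing.Theory Num.Theory.

Local Open Scope classical_set_scope.
Local Open Scope ring_scope.

(** Both halves rest on [borcherds], the coefficient form of the Jacobi identity, and on degree
    reasons, which make V_(0) a commutative associative algebra ([mul0C], [mul0A]) on which V_(1)
    acts by derivations ([derivation]). The trace argument is [not_simple_of_nontrivial_module]. It
    hands its m to [not_simple_of_stable_ideal], where the crucial point is [sub_top_ideal]: no word
    in modes of the generators carries m out of m in degree 0. For indecomposability,
    [indecomposable_of_idempotents] reduces to idempotents of V_(0) killed by D, and
    [idempotent_simple] and [idempotent_semisimple] show that only 0 and the vacuum occur. Both use
    [kerD_mul_eq0]: as k is nonzero, an element of Ker D that annihilates e vanishes. *)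

Section Subspaces.
Context {K : numFieldType} {V : lmodType K}.
Implicit Types W X : set V.

Lemma subspaceP W :
  subspace W <-> W 0 /\ forall c a b, W a -> W b -> W (c *: a + b).
Proof.
split=> [[/set_mem h0 h1]|[h0 h1]]; split=> //.
- by move=> c a b /mem_set ha /mem_set hb; apply/set_mem/(h1 c a b).
- exact: mem_set.
- by move=> c a b /set_mem ha /set_mem hb; apply/mem_set/h1.
Qed.

Section Closure.
Variable W : set V.
Hypothesis subW : subspace W.

Lemma subspace0 : W 0. Proof. by have /subspaceP[] := subW. Qed.

Lemma subspaceD a b : W a -> W b -> W (a + b).
Proof. by have /subspaceP[_ h] := subW; move=> *; rewrite -[a]scale1r;
  apply: h. Qed.

Lemma subspaceZ c a : W a -> W (c *: a).
Proof.
have /subspaceP[h0 h] := subW; move=> *; rewrite -[_ *: _]addr0; exact: h.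
Qed.

Lemma subspaceN a : W a -> W (- a).
Proof. by rewrite -scaleN1r; exact: subspaceZ. Qed.

Lemma subspaceB a b : W a -> W b -> W (a - b).
Proof. by move=> *; apply: subspaceD => //; apply: subspaceN. Qed.

Lemma subspace_sum (I : Type) (r : seq I) (P : pred I) (F : I -> V) :
  (forall i, P i -> W (F i)) -> W (\sum_(i <- r | P i) F i).
Proof. by move=> h; elim/big_ind : _ => //;
  [exact: subspace0|exact: subspaceD]. Qed.

End Closure.

Lemma lspan_subspace X : subspace (lspan X).
Proof.
apply/subspaceP; split=> [W [sW _]|c a b ha hb W hW]; first exact: subspace0.
by apply: (subspaceD hW.1); [apply: (subspaceZ hW.1); apply: ha|apply: hb].
Qed.

Lemma sub_lspan X : X `<=` lspan X.
Proof. exact: sub_gen_smallest. Qed.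

Lemma lspan_sub X W : subspace W -> X `<=` W -> lspan X `<=` W.
Proof. exact: smallest_sub. Qed.

End Subspaces.

(** The sums over Z^3 in [mul3] are supported on a ray, parametrised by [g], and truncation cuts the
    ray off at [N]. *)
Lemma fsbig_nat_image {M : nmodType} {J : choiceType} (g : nat -> J)
    (F : J -> M) (N : nat) :
  injective g -> (forall p, F p <> 0 -> exists i, p = g i) ->
  (forall i, (N <= i)%N -> F (g i) = 0) ->
  \sum_(p \in [set: J]) F p = \sum_(i < N) F (g i).
Proof.
move=> ginj Fg FN; rewrite (fsbig_ord _ N (F \o g)) /= -(fsbig_image `I_N g F);
  last first.
  by apply: in2W; exact: ginj.
apply/esym/fsbig_widen => // p [_ /= Np].
have [//|/eqP F0] := eqVneq (F p) 0.
have [i pE] := Fg p F0; case: Np; exists i => //=.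
by rewrite ltnNge; apply/negP => Ni; apply: F0; rewrite pE FN.
Qed.

Local Arguments delta_coef : simpl never.

(** * Binomial coefficients and the expansion of the delta function *)

Section FormalCalculus.
Context {K : numFieldType}.

Lemma zbinom0n (i : nat) : zbinom 0 i = (i == 0%N)%:R :> K.
Proof.
case: i => [|i]; rewrite /zbinom ?big_ord0 ?divr1 //=.
by rewrite big_ord_recl /= subrr !mul0r.
Qed.

Lemma zbinomn0 (n : int) : zbinom n 0 = 1 :> K.
Proof. by rewrite /zbinom big_ord0 divr1. Qed.

Lemma zbinomn1 (n : int) : zbinom n 1 = n%:~R :> K.
Proof. by rewrite /zbinom big_ord1 subr0 divr1. Qed.

Lemma zbinom_opp (n : int) (i : nat) :
  zbinom (- n) i = (-1) ^+ i * zbinom (n + i%:Z - 1) i :> K.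
Proof.
rewrite /zbinom mulrA; congr (_ / _).
rewrite -[in RHS](big_mkord xpredT (fun j => (n + i%:Z - 1)%:~R - j%:R))
  big_nat_rev.
have -> : (-1) ^+ i = \prod_(j < i) (-1) :> K by rewrite prodr_const card_ord.
rewrite big_mkord -big_split /=.
apply: eq_bigr => j _; rewrite add0n; have jlt := ltn_ord j.
rewrite natrB // -!natr1 !(rmorphB, rmorphD, rmorphN) /= -!pmulrn.
ring.
Qed.

Lemma zbinomN1 (i : nat) : zbinom (- 1) i = (-1) ^+ i :> K.
Proof.
rewrite zbinom_opp /zbinom;
  suff -> : \prod_(j < i) ((1 + i%:Z - 1)%:~R - j%:R) = i`!%:R :> K.
  by rewrite divff ?mulr1 // pnatr_eq0 -lt0n fact_gt0.
rewrite addrAC subrr add0r.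
rewrite -ffactnn ffact_prod natr_prod; apply: eq_bigr => j _.
by rewrite natrB // ltnW.
Qed.

Lemma delta_coef_neq0 (r s t : int) :
  delta_coef r s t <> 0 :> K -> exists2 i : nat, t = i & s = - r - 1 - i%:Z.
Proof.
case: t => // i; rewrite /delta_coef; case: eqP => // e _; exists i => //.
by lia.
Qed.

(** With the exponent of z fixed, the delta function is a binomial expansion in (r, i). Fixing the
    exponent of x instead gives, by upper negation, the binomials of [delta_coef_opp]. The first
    form serves the two products in the Jacobi identity, the second the iterate. *)
Lemma delta_coefE (r : int) (i : nat) :
  delta_coef (- r - 1) (r - i%:Z) i = (-1) ^+ i * zbinom r i :> K.
Proof.
rewrite /delta_coef; case: eqP => [_|h]; last by exfalso; apply: h; lia.
by congr (_ * zbinom _ _); lia.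
Qed.

Lemma delta_coef_opp (p : int) (i : nat) :
  delta_coef (p - i%:Z) (- p - 1) i = zbinom p i :> K.
Proof.
rewrite /delta_coef; case: eqP => [_|h]; last by exfalso; apply: h; lia.
by rewrite -[p in RHS]opprK zbinom_opp; congr (_ * zbinom _ _); lia.
Qed.

End FormalCalculus.

(** * Consequences of the Jacobi identity *)

Section Modes.
Context {K : numFieldType} {V : lmodType K} (A : vertex_algebra V).
Notation "u _[ n ] v" := (mode A u n v)
  (at level 31, n at level 0, right associativity, format "u  _[ n ]  v").
Notation vac := (vacuum A).

Lemma modeDl n v : {morph (fun u => u _[n] v) : a b / a + b}.
Proof. by move=> a b; have := mode_linearl A n v 1 a b; rewrite !scale1r. Qed.

Lemma modeDr u n : {morph mode A u n : a b / a + b}.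
Proof. by move=> a b; have := mode_linearr A u n 1 a b; rewrite !scale1r. Qed.

Lemma mode0l n v : 0 _[n] v = 0.
Proof. by apply: (addIr (0 _[n] v)); rewrite -modeDl !add0r. Qed.

Lemma mode0r u n : u _[n] 0 = 0.
Proof. by apply: (addIr (u _[n] 0)); rewrite -modeDr !add0r. Qed.

Lemma modeZl n v c u : (c *: u) _[n] v = c *: (u _[n] v).
Proof. by have := mode_linearl A n v c u 0; rewrite /= !addr0 mode0l addr0. Qed.

Lemma modeZr u n c v : u _[n] (c *: v) = c *: (u _[n] v).
Proof. by have := mode_linearr A u n c v 0; rewrite /= !addr0 mode0r addr0. Qed.

Lemma modeNl n v u : (- u) _[n] v = - (u _[n] v).
Proof. by rewrite -scaleN1r modeZl scaleN1r. Qed.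

Lemma modeNr u n v : u _[n] (- v) = - (u _[n] v).
Proof. by rewrite -scaleN1r modeZr scaleN1r. Qed.

Lemma mode_suml n v (I : Type) (r : seq I) (P : pred I) (F : I -> V) :
  (\sum_(i <- r | P i) F i) _[n] v = \sum_(i <- r | P i) (F i) _[n] v.
Proof. exact: (big_morph (fun u => u _[n] v) (modeDl n v) (mode0l n v)). Qed.

Lemma mode_sumr u n (I : Type) (r : seq I) (P : pred I) (F : I -> V) :
  u _[n] (\sum_(i <- r | P i) F i) = \sum_(i <- r | P i) u _[n] (F i).
Proof. exact: (big_morph (mode A u n) (modeDr u n) (mode0r u n)). Qed.

Lemma truncation_nat u v (n : int) :
  exists N : nat, forall i : nat, (N <= i)%N -> u _[n + i%:Z] v = 0.
Proof.
have [N hN] := truncation A u v; exists `|N - n|%N => i hi.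
by apply: hN; lia.
Qed.

(* The coefficient of x0^(- r - 1) x1^(- p - 1) x2^(- q - 1) in the Jacobi     *)
(* identity, with the sums cut off where their terms vanish.                   *)
Lemma borcherds u v w (p q r : int) (N1 N2 N3 : nat) :
  (forall i : nat, (N1 <= i)%N -> v _[q + i%:Z] w = 0) ->
  (forall i : nat, (N2 <= i)%N -> u _[p + i%:Z] w = 0) ->
  (forall i : nat, (N3 <= i)%N -> u _[r + i%:Z] v = 0) ->
  \sum_(i < N3) zbinom p i *: (u _[r + i%:Z] v) _[p + q - i%:Z] w =
  \sum_(i < N1) ((-1) ^+ i * zbinom r i) *: u _[p + r - i%:Z] v _[q + i%:Z] w -
  \sum_(i < N2) ((-1) ^ r * (-1) ^+ i * zbinom r i) *:
      v _[q + r - i%:Z] u _[p + i%:Z] w.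
Proof.
move=> h1 h2 h3.
have := jacobi A u v w (- r - 1) (- p - 1) (- q - 1); rewrite /mul3 => J.
(* The first two products of fields do not involve x0 and the third does not involve x1, so the
   delta function carries that whole exponent; what remains of its support is a ray. *)
pose g1 (i : nat) := ((- r - 1, r - i%:Z), i%:Z) : int * int * int.
pose g2 (i : nat) := ((- r - 1, i%:Z), r - i%:Z) : int * int * int.
pose g3 (i : nat) := ((i%:Z, - p - 1), p - i%:Z) : int * int * int.
rewrite (@fsbig_nat_image _ _ g1 _ N1) in J; first last.
- by move=> i /h1 hi /=;
  rewrite subrr eqxx (_ : - (- q - 1 - i%:Z) - 1 = q + i%:Z) ?hi ?mode0r
    ?scaler0 //; lia.
- move=> [[a b] c] /=; case: eqP => [ea|]; last by rewrite scaler0.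
  rewrite /delta_x0 => ne;
    have /delta_coef_neq0[i -> ->] : delta_coef a b c <> 0 :> K.
    by move=> d0; apply: ne; rewrite d0 scale0r.
  by exists i; rewrite /g1; congr (_, _, _); lia.
- by move=> i j [].
rewrite (@fsbig_nat_image _ _ g2 _ N2) in J; first last.
- by move=> i /h2 hi /=;
  rewrite subrr eqxx (_ : - (- p - 1 - i%:Z) - 1 = p + i%:Z) ?hi ?mode0r
    ?scaler0 //; lia.
- move=> [[a b] c] /=; case: eqP => [ea|]; last by rewrite scaler0.
  rewrite /delta_Nx0 => ne;
    have /delta_coef_neq0[i -> ->] : delta_coef a c b <> 0 :> K.
    by move=> d0; apply: ne; rewrite d0 mulr0 scale0r.
  by exists i; rewrite /g2; congr (_, _, _); lia.
- by move=> i j [].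
rewrite (@fsbig_nat_image _ _ g3 _ N3) in J; first last.
- by move=> i /h3 hi /=;
  rewrite subrr eqxx (_ : - (- r - 1 - i%:Z) - 1 = r + i%:Z) ?hi ?mode0l
    ?scaler0 //; lia.
- move=> [[a b] c] /=; case: eqP => [ea|]; last by rewrite scaler0.
  rewrite /delta_x2 => ne;
    have /delta_coef_neq0[i -> eb] : delta_coef c b a <> 0 :> K.
    by move=> d0; apply: ne; rewrite d0 scale0r.
  by exists i; rewrite /g3; congr (_, _, _); lia.
- by move=> i j [].
move: J; rewrite /= !subrr !eqxx => J.
transitivity (\sum_(i < N3) delta_x2 i%:Z (- p - 1) (p - i%:Z) *:
   (u _[- (- r - 1 - i%:Z) - 1] v) _[- (- q - 1 - (p - i%:Z)) - 1] w : V).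
  apply: eq_bigr => i _; rewrite /delta_x2 delta_coef_opp; congr (_ *: _).
  by congr (mode A (mode A _ _ _) _ _); lia.
rewrite -J; congr (_ - _); apply: eq_bigr => i _.
  rewrite /delta_x0 delta_coefE; congr (_ *: _).
  by congr (mode A _ _ (mode A _ _ _)); lia.
(* Here [delta_Nx0] contributes the sign (-1)^(-r), which equals (-1)^r. *)
rewrite /delta_Nx0 delta_coefE mulrA subrK -exprz_inv invrN1.
by congr (_ *: mode A _ _ (mode A _ _ _)); lia.
Qed.

(** The cutoff is a successor so that [big_ord_recl] can split off the term of index 0. *)
Lemma truncationS u v (n : int) :
  exists N : nat, forall i : nat, (N.+1 <= i)%N -> u _[n + i%:Z] v = 0.
Proof. by have [N hN] := truncation_nat u v n; exists N => i /ltnW;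
  exact: hN. Qed.

(** The case r = 0 of [borcherds]: only i = 0 survives on the right. Dually, [iterate] is the case p
    = 0. *)
Lemma commutator u v w (p q : int) (N : nat) :
  (forall i : nat, (N <= i)%N -> u _[i] v = 0) ->
  u _[p] v _[q] w - v _[q] u _[p] w =
  \sum_(i < N) zbinom p i *: (u _[i] v) _[p + q - i%:Z] w.
Proof.
move=> hN; have [N1 h1] := truncationS v w q; have [N2 h2] := truncationS u w p.
have hN' i : (N <= i)%N -> u _[0 + i%:Z] v = 0 by rewrite add0r; exact: hN.
have := borcherds h1 h2 hN'.
under eq_bigr do rewrite add0r; move=> ->.
congr (_ - _); rewrite big_ord_recl big1 => [|i _].
- by rewrite zbinomn0 mulr1 scale1r addr0 subr0 !addr0.
- by rewrite zbinom0n mulr0 scale0r.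
- by rewrite zbinomn0 !mulr1 scale1r addr0 subr0 !addr0.
- by rewrite zbinom0n mulr0 scale0r.
Qed.

Lemma iterate u v w (r q : int) (N1 N2 : nat) :
  (forall i : nat, (N1 <= i)%N -> v _[q + i%:Z] w = 0) ->
  (forall i : nat, (N2 <= i)%N -> u _[i] w = 0) ->
  (u _[r] v) _[q] w =
  \sum_(i < N1) ((-1) ^+ i * zbinom r i) *: u _[r - i%:Z] v _[q + i%:Z] w -
  \sum_(i < N2) ((-1) ^ r * (-1) ^+ i * zbinom r i) *:
      v _[q + r - i%:Z] u _[i] w.
Proof.
move=> h1 h2; have [N3 h3] := truncationS u v r.
have h2' i : (N2 <= i)%N -> u _[0 + i%:Z] w = 0 by rewrite add0r; exact: h2.
have := borcherds h1 h2' h3.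
under eq_bigr do rewrite add0r.
under [X in _ = X - _]eq_bigr do rewrite add0r.
under [X in _ = _ - X]eq_bigr do rewrite add0r.
move=> <-; rewrite big_ord_recl big1 => [|i _].
  by rewrite zbinomn0 scale1r subr0 !addr0.
by rewrite zbinom0n scale0r.
Qed.

(** Take w to be the vacuum, p = -1 and q = 0 in [borcherds]: creation kills the first sum, leaves
    only u_(-1) 1 = u in the second, and the binomials of -1 are signs. *)
Lemma skew_symmetry u v (r : int) (N : nat) :
  (forall i : nat, (N <= i)%N -> u _[r + i%:Z] v = 0) ->
  v _[r] u = (- (-1) ^ r) *:
    \sum_(i < N) (-1) ^+ i *: (u _[r + i%:Z] v) _[- 1 - i%:Z] vac.
Proof.
move=> h3.
have h1 i : (0 <= i)%N -> v _[0 + i%:Z] vac = 0.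
  by move=> _; apply: creation_regular.
have h2 i : (1 <= i)%N -> u _[-1 + i%:Z] vac = 0.
  by move=> hi; apply: creation_regular; lia.
have := borcherds h1 h2 h3;
  rewrite big_ord0 big_ord1 /= !addr0 ?subr0 !add0r ?creation.
rewrite zbinomn0 expr0 !mulr1.
under eq_bigr do rewrite zbinomN1; move=> ->.
by rewrite scalerN scaleNr opprK scalerA -expfzMl mulrNN mulr1 exp1rz scale1r.
Qed.

Lemma D_vacuum : D A vac = 0.
Proof. by rewrite /D vacuum_mode. Qed.

Lemma D_linear : linear (D A).
Proof. by move=> c u v; rewrite /D modeDl modeZl. Qed.

(** In the iterate formula for u_(-2) 1 the modes of the vacuum vanish except at -1, so at most one
    term survives: none for n = 0, one of the second sum for n > 0, one of the first for n < 0. *)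
Lemma mode_D u n w : (D A u) _[n] w = (- n%:~R) *: u _[n - 1] w.
Proof.
have zb2 i : (-1) ^+ i * zbinom (-2) i = i.+1%:R :> K.
  rewrite zbinom_opp mulrA -exprD addnn -mul2n exprM sqrrN !expr1n mul1r.
  rewrite (_ : 2 + i%:Z - 1 = i.+1); last by lia.
  rewrite /zbinom -[LHS]mulr1 -[X in _ * X = _](@divff _ i.+1%:R) ?pnatr_eq0 //.
  rewrite mulrACA -invfM -natrM mulnC -factS.
  rewrite mulrC -[\prod_(j < i) _]mulr1.
  have -> : \prod_(j < i) (i.+1%:Z%:~R - j%:R) = (i.+1)`!%:R :> K.
    rewrite -ffactnn ffact_prod natr_prod big_ord_recr /= subSnn mulr1.
    by apply: eq_bigr => j _; rewrite natrB //; have := ltn_ord j; lia.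
  by rewrite mulr1 mulrA mulVf ?mul1r // pnatr_eq0 -lt0n fact_gt0.
have vacm (m : int) x : m <> -1 -> vac _[m] x = 0.
  by move=> hm; rewrite vacuum_mode; case: eqP.
rewrite /D; have [N2 h2] := truncation_nat u w 0.
case: n => [[|n]|n].
- rewrite (@iterate _ _ _ _ _ 0 N2); last 2 first.
  + by move=> i _; apply: vacm; lia.
  + by move=> i hi; rewrite -[i%:Z]add0r h2.
  rewrite big_ord0 big1 ?subrr ?oppr0 ?scale0r // => i _.
  by rewrite vacm ?scaler0 //; lia.
(* The cutoff is enlarged so that the surviving index lies in range. *)
- rewrite (@iterate _ _ _ _ _ 0 (N2 + n.+1)%N); last 2 first.
  + by move=> i _; apply: vacm; lia.
  + by move=> i hi; rewrite -[i%:Z]add0r h2 //; lia.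
  rewrite big_ord0 sub0r.
  have hn : (n < N2 + n.+1)%N by lia.
  rewrite (bigD1 (Ordinal hn)) //= big1 => [|i /eqP ni]; last first.
    rewrite vacm ?scaler0 //; move=> e; apply: ni; apply: val_inj => /=; lia.
  rewrite addr0 vacuum_mode ifT; last by lia.
  rewrite -mulrA zb2 -scaleNr (_ : (-1) ^ (-2 : int) = 1 :> K); last first.
    by rewrite -exprz_inv invrN1 -exprnP sqrrN expr1n.
  rewrite mul1r; congr (_ *: mode A _ _ _); lia.
- rewrite (@iterate _ _ _ _ _ n.+1 N2); last 2 first.
  + by move=> i hi; apply: vacm; lia.
  + by move=> i hi; rewrite -[i%:Z]add0r h2.
  rewrite [X in _ - X]big1 => [|i _]; last by rewrite vacm ?scaler0 //; lia.
  rewrite big_ord_recr /= big1 => [|i _]; last first.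
    have ilt := ltn_ord i; rewrite vacm ?mode0r ?scaler0 //; lia.
  rewrite add0r subr0 vacuum_mode ifT; last by lia.
  by rewrite zb2 NegzE mulrNz opprK; congr (_ *: mode A _ _ _); lia.
Qed.

Lemma D_mode v n w : D A (v _[n] w) = v _[n] (D A w) - n%:~R *: v _[n - 1] w.
Proof.
rewrite {1}/D (@iterate _ _ _ _ _ 2 0); last 2 first.
- by move=> i hi; apply: creation_regular; lia.
- by move=> i _; apply: creation_regular.
rewrite big_ord0 subr0 big_ord_recl big_ord1 /= !addr0 expr0 zbinomn0.
by rewrite zbinomn1 expr1 mulr1 scale1r mulN1r creation scaleNr.
Qed.

(* [x_(- 1 - i) 1] is the divided power [D^i x / i!]. *)
Lemma mode_vacuum_closed (I : set V) : subspace I ->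
  (forall x, I x -> I (D A x)) ->
  forall (i : nat) x, I x -> I (x _[-1 - i%:Z] vac).
Proof.
move=> sI DI; elim=> [|i IH] x Ix; first by rewrite subr0 creation.
have -> : x _[-1 - i.+1%:Z] vac = i.+1%:R^-1 *: (D A x) _[-1 - i%:Z] vac.
  rewrite mode_D scalerA (_ : -1 - i%:Z = - i.+1%:Z); last by lia.
  rewrite mulrNz opprK mulVf ?pnatr_eq0 // scale1r; congr (mode A _ _ _); lia.
exact/(subspaceZ sI)/IH/DI.
Qed.

(** Skew symmetry writes w_n v through the vectors v_m w and their divided D-powers, so stability
    under left modes and D suffices. *)
Lemma va_idealP (I : set V) : subspace I -> (forall x, I x -> I (D A x)) ->
  (forall v n x, I x -> I (v _[n] x)) -> va_ideal A I.
Proof.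
move=> sI DI mI; split=> // v w n Iw; split; first exact: mI.
have [N hN] := truncation_nat v w n.
rewrite (skew_symmetry hN); apply: (subspaceZ sI);
  apply: (subspace_sum sI) => i _.
by apply: (subspaceZ sI); apply: mode_vacuum_closed => //; exact: mI.
Qed.

(* The modes of the generators suffice, since by the iterate formula the       *)
(* vectors whose modes preserve I form a vertex subalgebra.                    *)
Lemma generated_va_ideal (S I : set V) : generated_by A S -> subspace I ->
  (forall x, I x -> I (D A x)) ->
  (forall v n x, S v -> I x -> I (v _[n] x)) -> va_ideal A I.
Proof.
move=> gS sI DI SI; apply: va_idealP => // v n x Ix.
have Sv : smallest (vertex_subalgebra A) S v by rewrite gS.
pose B := [set v | forall n x, I x -> I (v _[n] x)].
suff: smallest (vertex_subalgebra A) S `<=` B by move=> /(_ v Sv); apply.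
apply: smallest_sub => /=.
  split=> [||{Ix Sv}u {}v m hu hv {}n {}x Ix].
  - apply/subspaceP; split=> [m y Iy|c u y hu hy m z Iz].
      by rewrite mode0l; apply: subspace0.
    by rewrite modeDl modeZl; apply: (subspaceD sI); [apply: (subspaceZ sI);
      exact: hu|exact: hy].
  - by move=> m y Iy; rewrite vacuum_mode; case: ifP => // _; exact: subspace0.
  - have [N1 h1] := truncation_nat v x n; have [N2 h2] := truncation_nat u x 0.
    rewrite (iterate (N2 := N2) _ h1) => [|i /h2]; last by rewrite add0r.
    by apply: (subspaceB sI); apply: (subspace_sum sI) => i _;
      apply: (subspaceZ sI);
      do ?[apply: hu|apply: hv].
by move=> y Sy m z; exact: SI.
Qed.

End Modes.

(** * The trace on a finite-dimensional subspace *)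

Section Trace.
Context {K : numFieldType} {V : lmodType K}.

(** The modes are operators on all of V, so the trace is set up for maps of V that preserve [W] and
    sees only their restrictions to [W]. *)
Lemma exists_trace (W : set V) (n : nat) : has_dim W n ->
  exists tr : (V -> V) -> K,
  [/\ forall T S, (forall x, W x -> T x = S x) -> tr T = tr S,
      forall c T S, (forall x, W x -> W (T x)) -> (forall x, W x -> W (S x)) ->
        tr (fun x => c *: T x + S x) = c * tr T + tr S,
      forall T S : V -> V, linear T -> linear S -> (forall x, W x -> W (T x)) ->
        (forall x, W x -> W (S x)) -> tr (T \o S) = tr (S \o T)
    & tr id = n%:R].
Proof.
move=> [b bfree WE].
pose phi (c : 'rV[K]_n) : V := \sum_i c 0 i *: b i.
have phi_linear c x y : phi (c *: x + y) = c *: phi x + phi y.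
  rewrite /phi scaler_sumr -big_split; apply: eq_bigr => i _.
  by rewrite !mxE scalerDl scalerA.
have phi_inj : injective phi.
  move=> x y /eqP; rewrite -subr_eq0 => /eqP e; apply/rowP => i; apply/eqP.
  rewrite -subr_eq0; apply/eqP/(bfree (fun i => x 0 i - y 0 i)).
  by rewrite -[RHS]e -sumrB; apply: eq_bigr => j _; rewrite scalerBl.
have Wphi c : W (phi c) by rewrite WE; exists (c 0).
have phi_surj x : W x -> exists c, phi c = x.
  rewrite WE => -[c ->]; exists (\row_i c i).
  by apply: eq_bigr => i _; rewrite mxE.
pose co x := xget 0 [set c | phi c = x].
have coK x : W x -> phi (co x) = x.
  by move=> /phi_surj[c cx]; rewrite /co; case: xgetP => [d -> //|/(_ c)].
have Kco c : co (phi c) = c by apply/phi_inj/coK.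
have co_linear c x y : W x -> W y -> co (c *: x + y) = c *: co x + co y.
  by move=> Wx Wy; rewrite -{1}(coK x) // -{1}(coK y) // -phi_linear Kco.
pose mx T := \matrix_i co (T (phi (delta_mx 0 i))) : 'M[K]_n.
have phi_sum (I : Type) (r : seq I) (F : I -> 'rV[K]_n) :
    phi (\sum_(i <- r) F i) = \sum_(i <- r) phi (F i).
  apply: (big_morph phi) => [x y|];
    first by rewrite -[x]scale1r phi_linear !scale1r.
  by rewrite /phi big1 // => i _; rewrite mxE scale0r.
have mxP T c : linear T -> (forall x, W x -> W (T x)) ->
    phi (c *m mx T) = T (phi c).
  move=> lT WT; have T0 : T 0 = 0.
    have := lT (-1) 0 0; rewrite scaler0 add0r scaleN1r addNr => h; exact: h.
  have Tsum (F : 'I_n -> V) : T (\sum_i F i) = \sum_i T (F i).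
    by apply: big_morph => // x y; have := lT 1 x y; rewrite !scale1r.
  have phiZ a x : phi (a *: x) = a *: phi x.
    by rewrite /phi scaler_sumr; apply: eq_bigr => i _; rewrite mxE scalerA.
  rewrite mulmx_sum_row phi_sum [in RHS](row_sum_delta c) phi_sum Tsum.
  apply: eq_bigr => i _; rewrite !phiZ rowK coK; last exact: WT.
  by have := lT (c 0 i) (phi (delta_mx 0 i)) 0; rewrite T0 !addr0.
exists (fun T => \tr (mx T)); split.
- by move=> T S TS; congr (\tr _); apply/matrixP => i j; rewrite !mxE TS.
- move=> c T S WT WS; rewrite -mxtraceZ -mxtraceD; congr (\tr _).
  by apply/matrixP => i j; rewrite !mxE co_linear ?mxE; auto.
- move=> T S lT lS WT WS.
  (* Row vectors are multiplied on the right, hence the reversed order. *)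
  have mx_comp (T' S' : V -> V) : linear T' -> (forall x, W x -> W (T' x)) ->
      (forall x, W x -> W (S' x)) -> mx (T' \o S') = mx S' *m mx T'.
    move=> lT' WT' WS'; apply/row_matrixP => i; rewrite row_mul !rowK.
    by apply: phi_inj; rewrite mxP // !coK //=; auto.
  by rewrite (mx_comp T S lT WT WS) (mx_comp S T lS WS WT); exact: mxtrace_mulC.
- suff -> : mx id = 1%:M by rewrite mxtrace1.
  by apply/row_matrixP => i; rewrite rowK Kco row1.
Qed.

End Trace.

(** * Homogeneous components *)

Section Grading.
Context {K : numFieldType} {V : lmodType K} (A : vertex_algebra V).
Notation "u _[ n ] v" := (mode A u n v)
  (at level 31, n at level 0, right associativity, format "u  _[ n ]  v").
Notation vac := (vacuum A).
Variable G : nat -> set V.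
Hypothesis hG : N_grading A G.

Let subG n : subspace (G n) := grading_subspace hG n.

Lemma mode_graded (k n j : nat) (m : int) u v : G k u -> G n v ->
  k%:Z + n%:Z - m - 1 = j%:Z -> G j (u _[m] v).
Proof. by move=> hu hv e; have := grading_mode hG m hu hv; rewrite e. Qed.

Lemma mode_graded0 (k n : nat) (m : int) u v : G k u -> G n v ->
  k%:Z + n%:Z - m - 1 < 0 -> u _[m] v = 0.
Proof. by move=> hu hv; have := grading_mode hG m hu hv; case: (_ - 1). Qed.

(** [grading_sum] says nothing of [x n] for n >= N; setting these to 0 makes the components
    unique. *)
Lemma component_subproof v : exists x : nat -> V, (forall n, G n (x n)) /\
  exists2 N, (forall n, (N <= n)%N -> x n = 0) & v = \sum_(n < N) x n.
Proof.
have [N [x [Gx ->]]] := grading_sum hG v.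
exists (fun n => if (n < N)%N then x n else 0); split=> [n|].
  by case: ifP => // _; exact: (subspace0 (subG n)).
exists N => [n|]; first by rewrite ltnNge => ->.
by apply: eq_bigr => i _; rewrite ltn_ord.
Qed.

Definition component v : nat -> V := projT1 (cid (component_subproof v)).

Lemma component_graded v n : G n (component v n).
Proof. by rewrite /component; case: cid => x /= []. Qed.

Lemma component_sum v : exists2 N,
  (forall n, (N <= n)%N -> component v n = 0) & v = \sum_(n < N) component v n.
Proof. by rewrite /component; case: cid => x /= []. Qed.

Lemma sum_widen (N M : nat) (x : nat -> V) : (N <= M)%N ->
  (forall n, (N <= n)%N -> x n = 0) -> \sum_(n < M) x n = \sum_(n < N) x n.
Proof.
move=> NM x0;
  rewrite -(subnKC NM) big_split_ord /= [X in _ + X]big1 ?addr0 // => i _.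
by apply: x0; rewrite leq_addr.
Qed.

Lemma component_unique v (x : nat -> V) N : (forall n, G n (x n)) ->
  (forall n, (N <= n)%N -> x n = 0) -> v = \sum_(n < N) x n ->
  component v =1 x.
Proof.
move=> Gx x0 vE n; have [M y0 yE] := component_sum v.
set y := component v in y0 yE *.
have [L [nL NL ML]] : exists L, [/\ n < L, N <= L & M <= L]%N.
  by exists (maxn n.+1 (maxn N M)); split; rewrite !leq_max leqnn ?orbT.
have L0 : \sum_(i < L) (y i - x i) = 0.
  by rewrite sumrB (sum_widen NL x0) (sum_widen ML y0) -vE -yE subrr.
apply/eqP; rewrite -subr_eq0; apply/eqP.
apply: (grading_direct hG (x := fun i => y i - x i) _ L0) => // i.
by apply: (subspaceB (subG i)); [exact: component_graded|exact: Gx].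
Qed.

Lemma component_linear n : linear (component ^~ n).
Proof.
move=> c u v; have [N u0 uE] := component_sum u;
  have [M v0 vE] := component_sum v.
apply: (@component_unique _ (fun n => c *: component u n + component v n)
  (maxn N M)).
- move=> i; apply: (subspaceD (subG i)); last exact: component_graded.
  by apply: (subspaceZ (subG i)); exact: component_graded.
- by move=> i hi; rewrite u0 ?v0 ?scaler0 ?addr0 //; lia.
rewrite big_split -scaler_sumr /=.
by rewrite (sum_widen (leq_maxl N M) u0) (sum_widen (leq_maxr N M) v0) -uE -vE.
Qed.

Lemma component_homogeneous n v i : G n v ->
  component v i = if i == n then v else 0.
Proof.
move=> Gv; apply: (@component_unique _ (fun i => if i == n then v else 0) n.+1).
- by move=> j; case: eqP => [->//|_]; exact: (subspace0 (subG j)).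
- by move=> j hj; case: eqP => // e; lia.
rewrite big_ord_recr /= eqxx big1 ?add0r // => j _.
by case: eqP => // e; have := ltn_ord j; lia.
Qed.

Lemma component_sumr (I : Type) (r : seq I) (P : pred I) (F : I -> V) n :
  component (\sum_(i <- r | P i) F i) n = \sum_(i <- r | P i) component (F i) n.
Proof.
have h0 : component 0 n = 0.
  by rewrite (component_homogeneous _ (subspace0 (subG n))); case: ifP.
apply: (big_morph (component ^~ n)) => // a b.
by have := component_linear n 1 a b; rewrite !scale1r.
Qed.

Lemma component_mode_low u (k : nat) (m : int) v (j : nat) :
  G k u -> j%:Z < k%:Z - m - 1 -> component (u _[m] v) j = 0.
Proof.
move=> Gu hj; have [N _ ->] := component_sum v.
rewrite mode_sumr component_sumr big1 // => i _.
have Gi := component_graded v i.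
rewrite (component_homogeneous (n := absz (k%:Z + i%:Z - m - 1)%R)).
  by case: eqP => // e; lia.
by apply: (mode_graded Gu Gi); lia.
Qed.

Lemma component_D v n : component (D A v) n.+1 = D A (component v n).
Proof.
have [N v0 vE] := component_sum v.
have GD i w : G i w -> G i.+1 (D A w).
  by move=> Gw; apply: (mode_graded Gw (grading_vacuum hG)); lia.
apply: (@component_unique _ (fun j => if j is i.+1 then D A (component v i)
  else 0) N.+1).
- case=> [|i]; first exact: (subspace0 (subG 0)).
  exact/GD/component_graded.
- by case=> // i hi; rewrite v0 // /D mode0l.
by rewrite big_ord_recl add0r {1}vE /D mode_suml.
Qed.

Lemma component_D0 v : component (D A v) 0 = 0.
Proof.
have [N v0 ->] := component_sum v.
rewrite /D mode_suml component_sumr big1 // => i _.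
by rewrite (@component_homogeneous i.+1) //;
  apply: (mode_graded (component_graded v i) (grading_vacuum hG)); lia.
Qed.

Lemma component_mul0 u v :
  component (u _[-1] v) 0 = component u 0 _[-1] component v 0.
Proof.
have [N u0 uE] := component_sum u; have [M v0 vE] := component_sum v.
have c0 i j : component (component u i _[-1] component v j) 0 =
    if 0%N == (i + j)%N then component u i _[-1] component v j else 0.
  apply: component_homogeneous.
  by apply: mode_graded; [exact: component_graded|exact: component_graded|lia].
rewrite [in LHS]uE -(@sum_widen N N.+1) // mode_suml component_sumr.
rewrite big_ord_recl [X in _ + X]big1 ?addr0 => [|i _].
  rewrite [in LHS]vE -(@sum_widen M M.+1) // mode_sumr component_sumr.
  rewrite big_ord_recl [X in _ + X]big1 ?addr0 => [|i _]; last by rewrite c0.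
  by rewrite c0.
by rewrite [in LHS]vE mode_sumr component_sumr big1.
Qed.

(* All components of p lie in degree >= n for each n, because u_{-1} v has     *)
(* degree |u| + |v|.                                                           *)
Lemma idempotent_eq0 p : p _[-1] p = p -> component p 0 = 0 -> p = 0.
Proof.
move=> pp p0; suff h n i : (i < n)%N -> component p i = 0.
  by have [N _ ->] := component_sum p; rewrite big1 // => i _; exact: (h i.+1).
elim: n i => [//|n IH] i hi; have [->//|i0] := eqVneq i 0%N.
have [N _ pE] := component_sum p.
rewrite -pp [X in X _[-1] _]pE mode_suml component_sumr big1 // => j _.
rewrite [X in mode A _ _ X]pE mode_sumr component_sumr big1 // => l _.
have Gj := component_graded p j; have Gl := component_graded p l.
have [jl|ijl] := eqVneq i (j + l)%N; last first.
  rewrite (@component_homogeneous (j + l)) ?(negbTE ijl) //.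
  by apply: (mode_graded Gj Gl); lia.
have [j0|j1] := eqVneq (j : nat) 0%N;
  first by rewrite j0 p0 mode0l (component_homogeneous _ (subspace0 (subG 0)))
    if_same.
by rewrite (IH l) ?mode0r ?(component_homogeneous _ (subspace0 (subG 0)))
  ?if_same //; lia.
Qed.

(** By degree, u_i v = 0 for i >= 2. The failure of antisymmetry is thus a D-image, which places
    Leib inside D V_(0). *)
Lemma skew_symmetry0 u v : G 1%N u -> G 1%N v ->
  v _[0] u = - (u _[0] v) + D A (u _[1] v).
Proof.
move=> Gu Gv; rewrite (skew_symmetry (u := u) (r := 0) (N := 2)); last first.
  by move=> i hi; apply: (mode_graded0 Gu Gv); lia.
rewrite big_ord_recl big_ord1 /= expr0z !addr0 creation expr0 expr1 scale1r
  !scaleN1r.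
by rewrite opprD opprK.
Qed.

Lemma mul0C_op a b w : G 0%N a -> G 0%N b ->
  a _[-1] b _[-1] w = b _[-1] a _[-1] w.
Proof.
move=> Ga Gb; apply/eqP; rewrite -subr_eq0; apply/eqP.
rewrite (@commutator _ _ _ _ _ _ _ _ 0) ?big_ord0 // => i _.
by apply: (mode_graded0 Ga Gb); lia.
Qed.

Lemma mul0_graded a b : G 0%N a -> G 0%N b -> G 0%N (a _[-1] b).
Proof. by move=> Ga Gb; apply: (mode_graded Ga Gb). Qed.

Lemma mul0C a b : G 0%N a -> G 0%N b -> a _[-1] b = b _[-1] a.
Proof.
by move=> Ga Gb; rewrite -{1}(creation A b) mul0C_op // creation.
Qed.

Lemma mul0A a b c : G 0%N a -> G 0%N b -> G 0%N c ->
  (a _[-1] b) _[-1] c = a _[-1] b _[-1] c.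
Proof.
move=> Ga Gb Gc; rewrite mul0C //; last exact: mul0_graded.
by rewrite mul0C_op // (mul0C Gc Gb).
Qed.

Lemma derivation u a w (n : int) :
  u _[0] a _[n] w = (u _[0] a) _[n] w + a _[n] u _[0] w.
Proof.
have [N hN] := truncation_nat A u a 0.
apply/eqP; rewrite -subr_eq; apply/eqP.
rewrite (@commutator _ _ _ _ _ _ _ _ N.+1).
  rewrite big_ord_recl big1 => [|i _];
    first by rewrite zbinomn0 scale1r subr0 add0r addr0.
  by rewrite zbinom0n scale0r.
by move=> i hi; rewrite -[i%:Z]add0r hN // ltnW.
Qed.

End Grading.

(** * Ideals of V cut out by their degree 0 part *)

Section IdealFromDegreeZero.
Context {K : numFieldType} {V : lmodType K} (A : vertex_algebra V).
Notation "u _[ n ] v" := (mode A u n v)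
  (at level 31, n at level 0, right associativity, format "u  _[ n ]  v").
Notation vac := (vacuum A).
Variable G : nat -> set V.
Hypothesis hG : N_grading A G.

Let subG n : subspace (G n) := grading_subspace hG n.

Definition generator (x : V * int) := (G 0%N `|` G 1%N) x.1.

Definition mode_word (s : seq (V * int)) (v : V) : V :=
  foldr (fun x w => x.1 _[x.2] w) v s.

Lemma mode_word_cat s t v : mode_word (s ++ t) v = mode_word s (mode_word t v).
Proof. exact: foldr_cat. Qed.

Lemma mode_word_linear s : linear (mode_word s).
Proof.
by elim: s => [//|x s IH] c u v; rewrite /= IH modeDr modeZr.
Qed.

Lemma mode_word0 s : mode_word s 0 = 0.
Proof. by elim: s => //= x s ->; rewrite mode0r. Qed.

Lemma component0 n : component hG 0 n = 0.
Proof. by rewrite (component_homogeneous hG _ (subspace0 (subG 0))) if_same.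
Qed.

Lemma generatorP x : generator x -> exists2 k, (k <= 1)%N & G k x.1.
Proof. by case=> [?|?]; [exists 0%N|exists 1%N]. Qed.

Lemma generator_mode u v (i : nat) (n : int) :
  (G 0%N `|` G 1%N) u -> (G 0%N `|` G 1%N) v -> generator (u _[i] v, n).
Proof.
move=> /(@generatorP (u, n))[k k1 /= Gu] /(@generatorP (v, n))[l l1 /= Gv].
have [neg|pos] := ltP (k%:Z + l%:Z - i%:Z - 1) 0.
  by left; rewrite /= (mode_graded0 hG Gu Gv neg); exact: (subspace0 (subG 0)).
have [e|e] : k%:Z + l%:Z - i%:Z - 1 = 0%N \/ k%:Z + l%:Z - i%:Z - 1 = 1%N by
  lia.
  by left; exact: (mode_graded hG Gu Gv e).
by right; exact: (mode_graded hG Gu Gv e).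
Qed.

Section Ideal.
Variable m : set V.
Hypothesis subm : subspace m.
Hypothesis mG : m `<=` G 0%N.
Hypothesis mM : forall a x, G 0%N a -> m x -> m (a _[-1] x).
Hypothesis m0 : forall u x, G 1%N u -> m x -> m (u _[0] x).

(** The largest subspace stable under the modes of the generators whose degree 0 components lie in
    [m]. *)
Definition top_ideal : set V := [set v | forall s,
  (forall x, x \in s -> generator x) -> m (component hG (mode_word s v) 0)].

Let comp_lin c u v : component hG (c *: u + v) 0 =
  c *: component hG u 0 + component hG v 0.
Proof. exact: component_linear. Qed.

Lemma top_ideal_subspace : subspace top_ideal.
Proof.
apply/subspaceP; split=> [s hs|c a b ha hb s hs].
  by rewrite mode_word0 component0; exact: subspace0.
rewrite mode_word_linear comp_lin; apply: (subspaceD subm); last exact: hb.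
by apply: (subspaceZ subm); exact: ha.
Qed.

Lemma top_ideal_mode x v :
  generator x -> top_ideal v -> top_ideal (x.1 _[x.2] v).
Proof.
move=> gx hv s hs; have := hv (rcons s x); rewrite -cats1 mode_word_cat; apply.
by move=> y; rewrite mem_cat inE => /orP[/hs//|/eqP ->].
Qed.

(** D is moved to the left through the word by [D, x_n] = - n x_(n-1); at the far left it has no
    component in degree 0. *)
Lemma top_ideal_D v : top_ideal v -> top_ideal (D A v).
Proof.
suff H s : (forall x, x \in s -> generator x) -> forall v, top_ideal v ->
    m (component hG (mode_word s (D A v)) 0).
  by move=> hv s hs; exact: H.
move: {v}s; apply: last_ind => [_ v _|s x IH hs v hv].
  by rewrite component_D0; exact: subspace0.
have gx : generator x by apply: hs; rewrite mem_rcons mem_head.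
have {}hs y : y \in s -> generator y by move=> ys; apply: hs;
  rewrite mem_rcons inE ys orbT.
rewrite -cats1 mode_word_cat /=.
have -> : x.1 _[x.2] D A v = x.2%:~R *: x.1 _[x.2 - 1] v + D A (x.1 _[x.2] v).
  by rewrite D_mode addrC subrK.
rewrite mode_word_linear comp_lin; apply: (subspaceD subm).
  apply: (subspaceZ subm).
  by apply: (@top_ideal_mode (x.1, x.2 - 1) v gx hv s hs).
by apply: (IH hs); exact: top_ideal_mode.
Qed.

(* A raising operator acting on a is moved to the left of the word, where it   *)
(* has no component in degree 0; the commutators are shorter words.            *)
Lemma sub_top_ideal : m `<=` top_ideal.
Proof.
move=> a ma s; have [n] := ubnP (size s).
elim: n s a ma => [//|n IH] s; case/lastP: s => [a ma _ _|s [x xn] a ma].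
  by rewrite /= (component_homogeneous hG _ (mG ma)).
rewrite size_rcons ltnS => sn hs.
have gx : generator (x, xn) by apply: hs; rewrite mem_rcons mem_head.
have {}hs y : y \in s -> generator y by move=> ys; apply: hs;
  rewrite mem_rcons inE ys orbT.
have [k k1 Gx] := generatorP gx.
rewrite -cats1 mode_word_cat /=.
(* The operator next to [a] lowers the degree and kills [a], or preserves it and stays in [m], or
   raises it; only the last case needs commutators. *)
have [neg|] := ltP (k%:Z + 0%:Z - xn - 1) 0.
  rewrite (mode_graded0 hG Gx (mG ma) neg).
  by apply: IH => //; exact: subspace0.
rewrite le_eqVlt => /orP[/eqP e|pos].
  apply: IH => //; case: k k1 Gx e => [|[|//]] _ Gx e.
    by rewrite (_ : xn = -1); [exact: mM|lia].
  by rewrite (_ : xn = 0); [exact: m0|lia].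
(* [t1] is the part of the word still to be crossed by the raising operator, [t2] the part already
   crossed. *)
suff H t1 t2 : (size t1 + size t2 < n)%N ->
    (forall y, y \in t1 ++ t2 -> generator y) ->
    m (component hG (mode_word t1 (x _[xn] mode_word t2 a)) 0).
  by apply: (H s [::]); rewrite ?addn0 ?cats0.
move: t1 t2; apply: last_ind => [t2 _ _|t1 [y yn] IH1 t2].
  by rewrite /= (component_mode_low hG _ Gx) /=; [exact: subspace0|lia].
rewrite size_rcons addSn => tn ht.
have gy : generator (y, yn) by apply: ht; rewrite mem_cat mem_rcons mem_head.
have {}ht z : z \in t1 ++ t2 -> generator z.
  by move=> zt; apply: ht; rewrite mem_cat mem_rcons inE -orbA -mem_cat zt orbT.
rewrite -cats1 mode_word_cat /=; set w := mode_word t2 a.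
have [N hN] := truncation_nat A y x 0.
have hN' i : (N <= i)%N -> y _[i] x = 0 by move=> /hN; rewrite add0r.
have -> : y _[yn] x _[xn] w = 1 *: x _[xn] y _[yn] w +
    \sum_(i < N) zbinom yn i *: (y _[i] x) _[yn + xn - i%:Z] w.
  by rewrite -(commutator _ _ _ hN') scale1r addrC subrK.
rewrite mode_word_linear comp_lin scale1r; apply: (subspaceD subm).
  apply: (IH1 ((y, yn) :: t2)); first by rewrite addnS.
  move=> z; rewrite mem_cat inE orbCA => /orP[/eqP -> //|zt].
  by apply: ht; rewrite mem_cat.
have mword0 : m (component hG (mode_word t1 0) 0) by rewrite mode_word0
  component0; exact: subspace0.
elim/big_ind : _ => [|u v hu hv|i _].
- exact: mword0.
- by rewrite -[u]scale1r mode_word_linear comp_lin scale1r;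
  apply: (subspaceD subm).
- rewrite -[_ *: _]addr0 mode_word_linear comp_lin.
  apply: (subspaceD subm) => //.
  apply: (subspaceZ subm).
  pose z := (y _[i] x, yn + xn - i%:Z).
  have := IH (t1 ++ z :: t2) a ma; rewrite mode_word_cat /=; apply.
    by rewrite size_cat /= addnS.
  move=> z'; rewrite mem_cat inE orbCA => /orP[/eqP ->|zt].
    exact: generator_mode.
  by apply: ht; rewrite mem_cat.
Qed.

Hypothesis hgen : generated_by A (G 0%N `|` G 1%N).
Hypothesis mvac : ~ m vac.

Lemma not_simple_of_stable_ideal x : m x -> x <> 0 -> ~ va_simple A.
Proof.
move=> mx xN0 simpleA; have iI : va_ideal A top_ideal.
  apply: (generated_va_ideal hgen top_ideal_subspace top_ideal_D).
  by move=> v n y gv; apply: (@top_ideal_mode (v, n)).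
have [I0|IT] := simpleA _ iI.
  by have := sub_top_ideal mx; rewrite I0.
have : top_ideal vac by rewrite IT.
by move=> /(_ [::]);
  rewrite /= (component_homogeneous hG _ (grading_vacuum hG)) => /(_ _)/mvac;
    apply.
Qed.

End Ideal.

End IdealFromDegreeZero.

(** * Simplicity and decompositions *)

Section Simplicity.
Context {K : numFieldType} {V : lmodType K} (A : vertex_algebra V).
Notation "u _[ n ] v" := (mode A u n v)
  (at level 31, n at level 0, right associativity, format "u  _[ n ]  v").
Notation vac := (vacuum A).
Variable G : nat -> set V.
Hypothesis hG : N_grading A G.

Let subG n : subspace (G n) := grading_subspace hG n.

Lemma not_simple_of_nontrivial_module (n : nat) : (0 < n)%N ->
  has_dim (G 0%N) n -> generated_by A (G 0%N `|` G 1%N) ->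
  ~ trivial_module A (G 1%N) (G 0%N) -> ~ va_simple A.
Proof.
move=> n0 dimG0 hgen hnt simpleA; apply: hnt => u a Gu Ga.
have [tr [tr_ext tr_lin tr_comm tr1]] := exists_trace dimG0.
have lin x j : linear (mode A x j) by move=> c y z; rewrite modeDr modeZr.
have GL x y : G 0%N x -> G 0%N y -> G 0%N (x _[-1] y) by exact: mul0_graded.
have GU v x : G 1%N v -> G 0%N x -> G 0%N (v _[0] x).
  by move=> Gv Gx; apply: (mode_graded hG Gv Gx).
pose m := [set x | G 0%N x /\ forall y, G 0%N y ->
  tr (mode A x (-1) \o mode A y (-1)) = 0].
have m_der v x : G 1%N v -> G 0%N x -> m (v _[0] x).
  move=> Gv Gx; split=> [|y Gy]; first exact: GU.
  (* Multiplication by v_0 x is the commutator of v_0 with multiplication by x. *)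
  rewrite (tr_ext _ (fun z =>
    (-1) *: x _[-1] v _[0] y _[-1] z + v _[0] x _[-1] y _[-1] z)); last first.
    by move=> z Gz /=; rewrite (derivation A v x) scaleN1r [RHS]addrC addrK.
  rewrite (tr_lin _ (mode A x (-1) \o (mode A v 0 \o mode A y (-1)))
    (mode A v 0 \o (mode A x (-1) \o mode A y (-1)))) /=; last 2 first.
  - by move=> z Gz /=; auto.
  - by move=> z Gz /=; auto.
  (* Cyclicity moves multiplication by x to the far right; commutativity of V_(0) then identifies
     the two terms. *)
  rewrite (tr_comm (mode A x (-1)) (mode A v 0 \o mode A y (-1))); last 4 first.
  - exact: lin.
  - by move=> c z1 z2 /=; rewrite !lin.
  - by move=> z Gz; auto.
  - by move=> z Gz /=; auto.
  rewrite (tr_ext _ (mode A v 0 \o (mode A x (-1) \o mode A y (-1))));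
    first by rewrite mulN1r addNr.
  by move=> z Gz /=; rewrite (mul0C_op hG).
have subm : subspace m.
  apply/subspaceP; split=> [|c x y [Gx hx] [Gy hy]].
    split=> [|y Gy]; first exact: (subspace0 (subG 0)).
    (* The zero operator is written as - id + id, so that linearity gives its trace. *)
    rewrite (tr_ext _ (fun z => (-1) *: id z + id z)); last first.
      by move=> z _ /=; rewrite mode0l scaleN1r addNr.
    by rewrite tr_lin // mulN1r addNr.
  split=> [|z Gz]; first by apply: (subspaceD (subG 0)) => //;
    exact: (subspaceZ (subG 0)).
  rewrite (tr_ext _ (fun w => c *: x _[-1] z _[-1] w + y _[-1] z _[-1] w));
    last first.
    by move=> w _ /=; rewrite modeDl modeZl.
  rewrite (tr_lin _ (mode A x (-1) \o mode A z (-1))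
    (mode A y (-1) \o mode A z (-1))) /=; [|by move=> *; auto..].
  by rewrite hx // hy // mulr0 addr0.
apply: contrapT => ua0;
  case: (@not_simple_of_stable_ideal _ _ _ _ hG m subm _ _ _ hgen _ (u _[0] a))
    => //.
- by move=> x [].
- move=> x y Gx [Gy hy]; split=> [|z Gz]; first exact: GL.
  rewrite (tr_ext _ (mode A y (-1) \o mode A (x _[-1] z) (-1)));
    first by apply: hy; exact: GL.
  move=> w Gw /=; rewrite (mul0A hG) //; last exact: GL.
  by rewrite (mul0A hG Gx Gz Gw) (mul0C_op hG).
- by move=> v x Gv [Gx _]; exact: m_der.
- move=> [_ /(_ vac (grading_vacuum hG))].
  rewrite (tr_ext _ id); last by move=> x _ /=; rewrite !vacuum_mode.
  by rewrite tr1 => /eqP; rewrite pnatr_eq0; case: (n) n0.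
- exact: m_der.
Qed.

(** * Elements of Ker D act by operators commuting with all modes *)

Section CentralIdempotent.
Variable p : V.
Hypothesis Dp : D A p = 0.

(** From 0 = (D p)_(n+1) = - (n+1) p_n; so Y(p, x) is the constant p_(-1). *)
Lemma mode_kerD (n : int) w : n != -1 -> p _[n] w = 0.
Proof.
move=> n1; have := mode_D A p (n + 1) w.
rewrite Dp mode0l addrK => /esym/eqP; rewrite scaler_eq0 oppr_eq0 intr_eq0.
by rewrite addr_eq0 (negbTE n1) => /eqP.
Qed.

Lemma kerD_mode_comm v (n : int) w : p _[-1] v _[n] w = v _[n] p _[-1] w.
Proof.
apply/eqP; rewrite -subr_eq0; apply/eqP;
  rewrite (@commutator _ _ _ _ _ _ _ _ 0) ?big_ord0 //.
by move=> i _; apply: mode_kerD.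
Qed.

Lemma kerD_mode_assoc v (n : int) w : (p _[-1] v) _[n] w = p _[-1] v _[n] w.
Proof.
have [N hN] := truncationS A v w n.
rewrite (@iterate _ _ _ _ _ _ _ _ N.+1 0) //; last by move=> i _;
  apply: mode_kerD.
rewrite big_ord0 subr0 big_ord_recl big1 => [|i _]; last first.
  by rewrite mode_kerD ?scaler0 //; lia.
by rewrite zbinomn0 !mulr1 scale1r !addr0.
Qed.

Lemma kerD_D v : D A (p _[-1] v) = p _[-1] D A v.
Proof. exact: kerD_mode_assoc. Qed.

End CentralIdempotent.

(** Skew symmetry with v = u gives 2 u_0 u = D (u_1 u). *)
Lemma Leib_sub_D : Leib (bracket0 A) (G 1%N) `<=` [set D A a | a in G 0%N].
Proof.
apply: lspan_sub.
  apply/subspaceP; split; first by exists 0;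
    [exact: (subspace0 (subG 0))|rewrite /D mode0l].
  move=> c _ _ [a Ga <-] [b Gb <-]; exists (c *: a + b); last exact: D_linear.
  by apply: (subspaceD (subG 0)) => //; exact: (subspaceZ (subG 0)).
move=> _ [u Gu <-]; exists (2^-1 *: u _[1] u).
  by apply: (subspaceZ (subG 0)); apply: (mode_graded hG Gu Gu).
have /eqP := skew_symmetry0 hG Gu Gu.
rewrite addrC -subr_eq opprK -mulr2n => /eqP e.
have -> : D A (2^-1 *: u _[1] u) = 2^-1 *: D A (u _[1] u) by rewrite /D modeZl.
by rewrite -e -scaler_nat scalerA mulVf ?scale1r // pnatr_eq0.
Qed.

Lemma Leib_mode0 x a : Leib (bracket0 A) (G 1%N) x -> x _[0] a = 0.
Proof. by move=> /Leib_sub_D[c _ <-]; rewrite mode_D oppr0 scale0r. Qed.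

Section Idempotents.
Variables (e f : V) (k : K).
Hypothesis Ge : G 1%N e.
Hypothesis Gf : G 1%N f.
Hypothesis hk : k <> 0.
Hypothesis ef1 : e _[1] f = k *: vac.

Lemma kerD_mul_eq0 p : D A p = 0 -> p _[-1] e = 0 -> p = 0.
Proof.
move=> Dp pe; have := kerD_mode_assoc Dp e 1 f.
rewrite pe mode0l ef1 modeZr creation => /esym/eqP; rewrite scaler_eq0.
by case/orP=> /eqP.
Qed.

Let G1mul p u : G 0%N p -> G 1%N u -> G 1%N (p _[-1] u).
Proof. by move=> Gp Gu; apply: (mode_graded hG Gp Gu). Qed.

Lemma idempotent_compl p : G 0%N p -> D A p = 0 -> p _[-1] p = p ->
  [/\ G 0%N (vac - p), D A (vac - p) = 0 & (vac - p) _[-1] (vac - p) = vac - p].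
Proof.
move=> Gp Dp pp; split.
- by apply: (subspaceB (subG 0)) => //; exact: grading_vacuum hG.
- by rewrite /D modeDl modeNl -!/(D A _) Dp D_vacuum subr0.
- rewrite modeDl modeNl vacuum_mode eqxx modeDr modeNr creation pp.
  by rewrite subrr subr0.
Qed.

Lemma image_leibniz_ideal p : G 0%N p -> D A p = 0 ->
  leibniz_ideal (bracket0 A) (G 1%N) [set p _[-1] u | u in G 1%N].
Proof.
move=> Gp Dp; split.
- apply/subspaceP; split; first by exists 0;
  [exact: (subspace0 (subG 1))|rewrite mode0r].
  move=> c _ _ [a Ga <-] [b Gb <-]; exists (c *: a + b);
    last by rewrite modeDr modeZr.
  by apply: (subspaceD (subG 1)) => //; exact: (subspaceZ (subG 1)).
- by move=> _ [u Gu <-]; exact: G1mul.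
- move=> a _ Ga [u Gu <-]; split.
    by exists (a _[0] u);
      [apply: (mode_graded hG Ga Gu)|rewrite kerD_mode_comm].
  by exists (u _[0] a);
    [apply: (mode_graded hG Gu Ga)|rewrite /bracket0 kerD_mode_assoc].
Qed.

Lemma idempotent_simple p : leibniz_simple (bracket0 A) (G 1%N) ->
  (exists2 u, G 1%N u & u _[0] u <> 0) ->
  G 0%N p -> D A p = 0 -> p _[-1] p = p -> p = 0 \/ p = vac.
Proof.
move=> [_ simpleL] [u Gu uu] Gp Dp pp;
  have [Gq Dq qq] := idempotent_compl Gp Dp pp.
have qE v : (vac - p) _[-1] v = v - p _[-1] v.
  by rewrite modeDl modeNl vacuum_mode eqxx.
have p0 : p _[-1] e = 0 -> p = 0 \/ p = vac by left; exact: kerD_mul_eq0.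
have q0 : (vac - p) _[-1] e = 0 -> p = 0 \/ p = vac.
  by right; apply/esym/eqP; rewrite -subr_eq0; apply/eqP; exact: kerD_mul_eq0.
have im r : [set r _[-1] v | v in G 1%N] (r _[-1] e) by exists e.
have pfix x : [set p _[-1] v | v in G 1%N] x -> p _[-1] x = x.
  by move=> [v _ <-]; rewrite -(kerD_mode_assoc Dp) pp.
have qfix x : [set (vac - p) _[-1] v | v in G 1%N] x -> p _[-1] x = 0.
  by move=> [v _ <-];
    rewrite qE modeDr modeNr -[p _[-1] p _[-1] v](kerD_mode_assoc Dp) pp subrr.
have [I0|IL|IG] := simpleL _ (image_leibniz_ideal Gp Dp).
- by apply: p0; have := im p; rewrite I0.
- have [J0|JL|JG] := simpleL _ (image_leibniz_ideal Gq Dq).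
  + by apply: q0; have := im (vac - p); rewrite J0.
  (* Both images equal Leib, so u_0 u is at once fixed and killed by p_(-1). *)
  + case: uu;
    have Lu : Leib (bracket0 A) (G 1%N) (u _[0] u) by apply: sub_lspan;
      exists u.
    by rewrite -[LHS]pfix ?IL // qfix ?JL.
  + by apply: p0; apply: qfix; rewrite JG.
- by apply: q0; rewrite qE pfix ?subrr // IG.
Qed.

Section Semisimple.
Variable h : V.
Hypothesis hef : e _[0] f = h.
Hypothesis hhe : h _[0] e = 2 *: e.
Hypothesis hhf : h _[0] f = (- 2) *: f.
Let S := lspan [set e; f; h].
Let L0 := Leib (bracket0 A) (G 1%N).
Hypothesis lieS : lie_algebra (bracket0 A) S.
Hypothesis sumS : direct_sum (G 1%N) S L0.
Hypothesis idealL0 : leibniz_ideal (bracket0 A) (G 1%N) L0.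
Hypothesis kerD : forall a, G 0%N a -> (forall b, G 1%N b -> b _[0] a = 0) ->
  D A a = 0.

Let subL0 : subspace L0. Proof. exact: lspan_subspace. Qed.
Let subS : subspace S. Proof. exact: lspan_subspace. Qed.

Let L0l a x : G 1%N a -> L0 x -> L0 (a _[0] x).
Proof. by case: idealL0 => _ _ H Ga Lx; case: (H a x Ga Lx). Qed.

Let L0r a x : G 1%N a -> L0 x -> L0 (x _[0] a).
Proof. by case: idealL0 => _ _ H Ga Lx; case: (H a x Ga Lx). Qed.

Lemma idempotent_Leib_eq0 p : G 0%N p -> D A p = 0 -> p _[-1] p = p ->
  L0 (p _[-1] e) -> p = 0.
Proof.
move=> Gp Dp pp Lpe; apply: kerD_mul_eq0 => //.
have Gh : G 1%N h by rewrite -hef; apply: (mode_graded hG Ge Gf).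
have Lph : L0 (p _[-1] h) by rewrite -hef -(kerD_mode_assoc Dp); exact: L0r.
have Lpf : L0 (p _[-1] f).
  have -> : p _[-1] f = (- 2^-1) *: (p _[-1] h) _[0] f.
    by rewrite (kerD_mode_assoc Dp) hhf modeZr scalerA mulrNN mulVf ?scale1r //
      pnatr_eq0.
  by apply: (subspaceZ subL0); exact: L0r.
have Dpa a : G 0%N a -> D A (p _[-1] a) = 0.
  move=> Ga; apply: kerD => [|b]; first exact: mul0_graded.
  case: sumS => -> _ [s Ss [l Ll <-]]; rewrite modeDl (Leib_mode0 _ Ll) addr0.
  pose Z := [set s | s _[0] p _[-1] a = 0].
  suff : S `<=` Z by exact.
  apply: lspan_sub.
    apply/subspaceP; split; first by rewrite /Z /= mode0l.
    by move=> c x y; rewrite /Z /= => hx hy;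
      rewrite modeDl modeZl hx hy scaler0 addr0.
  (* For s among e, f, h, s_0 (p a) = (p s)_0 a, and p s lies in Leib, whose elements act by 0. *)
  by move=> x [[|]|] -> /=;
    rewrite /Z /= -(kerD_mode_comm Dp) -(kerD_mode_assoc Dp) Leib_mode0.
have [c Gc ce] := Leib_sub_D Lpe.
by rewrite -pp (kerD_mode_assoc Dp) -ce -(kerD_D Dp) Dpa.
Qed.

Let spanS s : S s -> exists a b c, s = a *: e + b *: f + c *: h.
Proof.
pose Z := [set s | exists a b c, s = a *: e + b *: f + c *: h].
suff : S `<=` Z by move=> SZ /SZ.
apply: lspan_sub.
  apply/subspaceP; split; first by exists 0, 0, 0; rewrite !scale0r !addr0.
  move=> t _ _ [a [b [c ->]]] [a' [b' [c' ->]]].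
  exists (t * a + a'), (t * b + b'), (t * c + c').
  by rewrite !scalerDr !scalerA addrACA [X in X + _]addrACA -!scalerDl.
move=> x [[|]|] ->.
- by exists 1, 0, 0; rewrite !scale0r scale1r !addr0.
- by exists 0, 1, 0; rewrite !scale0r scale1r addr0 add0r.
- by exists 0, 0, 1; rewrite !scale0r scale1r !add0r.
Qed.

Lemma idempotent_semisimple p : G 0%N p -> D A p = 0 -> p _[-1] p = p ->
  p = 0 \/ p = vac.
Proof.
move=> Gp Dp pp.
have Gh : G 1%N h by rewrite -hef; apply: (mode_graded hG Ge Gf).
have Sh : S h by apply: sub_lspan; right.
(* Since p is idempotent, p [u, u] = [p u, p u]. *)
have pL0 x : L0 x -> L0 (p _[-1] x).
  pose Z := [set x | L0 (p _[-1] x)].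
  suff : L0 `<=` Z by exact.
  apply: lspan_sub.
    apply/subspaceP; split; first by rewrite /Z /= mode0r; exact: subspace0.
    move=> c y z; rewrite /Z /= => hy hz; rewrite modeDr modeZr.
    by apply: (subspaceD subL0) => //; exact: (subspaceZ subL0).
  move=> _ [u Gu <-]; rewrite /Z /=; apply: sub_lspan; exists (p _[-1] u);
    first exact: G1mul.
  by rewrite /bracket0 (kerD_mode_assoc Dp) -(kerD_mode_comm Dp)
    -[LHS](kerD_mode_assoc Dp) pp.
have : G 1%N (p _[-1] e) by exact: G1mul.
case: sumS => {1}-> S0 [s Ss [l Ll slE]].
(* h_0 preserves both summands S and Leib, so the S-part of the eigenvector p e is again an
   eigenvector for 2. *)
have hs : h _[0] s = 2 *: s.
  have hpe : h _[0] (p _[-1] e) = 2 *: p _[-1] e by rewrite -(kerD_mode_comm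
    Dp) hhe modeZr.
  have : (S `&` L0) (h _[0] s - 2 *: s).
    split.
      apply: (subspaceB subS); last exact: (subspaceZ subS).
      by have [_ cl _ _ _] := lieS.1; apply: cl.
    have -> : h _[0] s - 2 *: s = 2 *: l - h _[0] l.
      move: hpe; rewrite -slE modeDr scalerDr => hpe; apply/eqP.
      by rewrite subr_eq addrAC eq_sym subr_eq hpe addrC.
    by apply: (subspaceB subL0); [exact: (subspaceZ subL0)|exact: L0l].
  by rewrite S0 => /eqP; rewrite subr_eq0 => /eqP.
have [a [b [c sE]]] := spanS Ss.
have hh : h _[0] h = 0 by exact: lieS.2.
have bf_ch : 2 *: (b *: f) + c *: h = 0.
  have : 2 *: (a *: e) + - (2 *: (b *: f)) =
         2 *: (a *: e) + (2 *: (b *: f) + 2 *: (c *: h)).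
    rewrite addrA -!scalerDr -sE -hs sE !modeDr !modeZr hh hhe hhf scaler0
      addr0.
    by rewrite -scaleNr !scalerA [2 * a]mulrC [-2 * b]mulrC.
  move=> /addrI bc; have : 2 *: (2 *: (b *: f) + c *: h) == 0.
    by rewrite scalerDr scaler_nat mulr2n -addrA -bc subrr.
  by rewrite scaler_eq0 pnatr_eq0 => /eqP.
have bf : b *: f = 0.
  have := congr1 (mode A h 0) bf_ch;
    rewrite modeDr !modeZr hh mode0r scaler0 addr0 hhf.
  rewrite [b *: _]scalerA [b * _]mulrC -scalerA scalerA => /eqP;
    rewrite scaler_eq0.
  by rewrite mulf_eq0 oppr_eq0 pnatr_eq0 /= => /eqP.
have {}sE : s = a *: e.
  by move: bf_ch; rewrite sE bf scaler0 add0r => ->; rewrite !addr0.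
(* Apply p to p e = a e + l. *)
have pe : (1 - a) *: p _[-1] e = p _[-1] l.
  rewrite scalerBl scale1r; apply/eqP;
    rewrite subr_eq addrC -{1}pp (kerD_mode_assoc Dp).
  by rewrite -{1}slE sE modeDr modeZr.
have [a1|a1] := eqVneq a 1.
  right; apply/esym/eqP; rewrite -subr_eq0; apply/eqP.
  have [Gq Dq qq] := idempotent_compl Gp Dp pp.
  apply: idempotent_Leib_eq0 => //.
  rewrite modeDl modeNl vacuum_mode eqxx -slE sE a1 scale1r opprD addNKr.
  exact: (subspaceN subL0).
left; apply: idempotent_Leib_eq0 => //.
have -> : p _[-1] e = (1 - a)^-1 *: p _[-1] l.
  by rewrite -pe scalerA mulVf ?scale1r // subr_eq0 eq_sym.
by apply: (subspaceZ subL0); exact: pL0.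
Qed.

End Semisimple.
End Idempotents.

(** The components p and q of the vacuum in the two ideals are complementary idempotents, and D p =
    - D q lies in both ideals. *)
Lemma indecomposable_of_idempotents :
  (forall p, G 0%N p -> D A p = 0 -> p _[-1] p = p -> p = 0 \/ p = vac) ->
  indecomposable A.
Proof.
move=> idem [U [W [[[sU iU] [sW iW]] [U0 _] [W0 _] [sumUW UW0]]]].
have : [set: V] vac by []; rewrite sumUW => -[p Up [q Wq pqE]].
have UWeq0 x : U x -> W x -> x = 0.
  by move=> Ux Wx; have : (U `&` W) x by []; rewrite UW0.
have Dp : D A p = 0.
  apply: UWeq0; first by have [] := iU vac p (-2) Up.
  have -> : D A p = - D A q.
    by apply/eqP; rewrite -addr_eq0 -modeDl pqE -/(D A vac) D_vacuum.
  by apply: (subspaceN sW); have [] := iW vac q (-2) Wq.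
have pW w : W w -> p _[-1] w = 0.
  by move=> Ww; apply: UWeq0;
    [have [] := iU w p (-1) Up|have [] := iW p w (-1) Ww].
have qU u : U u -> q _[-1] u = 0.
  by move=> Uu; apply: UWeq0;
    [have [] := iU q u (-1) Uu|have [] := iW u q (-1) Wq].
have decomp v : v = p _[-1] v + q _[-1] v by rewrite -modeDl pqE vacuum_mode.
have p0 : p <> 0.
  move=> p0; apply: U0; apply/seteqP; split=> [u Uu|_ ->];
    last exact: subspace0.
  by rewrite /= (decomp u) qU // p0 mode0l addr0.
have q0 : q <> 0.
  move=> q0; apply: W0; apply/seteqP; split=> [w Ww|_ ->];
    last exact: subspace0.
  by rewrite /= (decomp w) pW // q0 mode0l addr0.
have pp : p _[-1] p = p by rewrite [RHS]decomp qU // addr0.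
have qq : q _[-1] q = q by rewrite [RHS]decomp pW // add0r.
(* p need not be homogeneous, so the hypothesis is applied to its degree 0 part; [idempotent_eq0]
   returns from there to p or q. *)
have pq0 : component hG p 0 + component hG q 0 = vac.
  have := component_linear hG 0 1 p q; rewrite !scale1r pqE => <-.
  by rewrite (component_homogeneous hG _ (grading_vacuum hG)).
have Dp0 : D A (component hG p 0) = 0 by rewrite -(component_D hG) Dp
  component0.
have pp0 : component hG p 0 _[-1] component hG p 0 = component hG p 0.
  by rewrite -component_mul0 pp.
have [e|e] := idem _ (component_graded hG p 0) Dp0 pp0.
- by apply: p0; exact: (idempotent_eq0 pp e).
- apply: q0; apply: (idempotent_eq0 (hG := hG) qq).
  by apply: (addrI vac); rewrite addr0 -[RHS]pq0 e.
Qed.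

End Simplicity.

Theorem theorem2 (R : realType) (V : lmodType R[i]) (A : vertex_algebra V)
    (G : nat -> set V) (hG : N_grading A G)
    (hdim0 : exists2 d0 : nat, (2 <= d0)%N & has_dim (G 0%N) d0)
    (hdim1 : exists2 d1 : nat, (1 <= d1)%N & has_dim (G 1%N) d1)
    (hgen : generated_by A (G 0%N `|` G 1%N))
    (hnontriv : ~ trivial_module A (G 1%N) (G 0%N))
    (hnonlie : exists2 u : V, G 1%N u & mode A u 0 u <> 0)
    (e f h : V) (k : R[i])
    (hlevi : levi_factor (bracket0 A) (G 1%N) (lspan [set e; f; h]))
    (hef : mode A e 0 f = h)
    (hhe : mode A h 0 e = 2 *: e)
    (hhf : mode A h 0 f = (- 2) *: f)
    (hk : k <> 0)
    (hef1 : mode A e 1 f = k *: vacuum A)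
    (hcase :
      leibniz_simple (bracket0 A) (G 1%N) \/
      (leibniz_semisimple (bracket0 A) (G 1%N) /\
       [set a | D A a = 0] `&` G 0%N =
         [set a | G 0%N a /\ forall b, G 1%N b -> mode A b 0 a = 0])) :
  indecomposable A /\ ~ va_simple A.
Proof.
have [SG lieS _ [J radJ sumSJ]] := hlevi.
have Ge : G 1%N e by apply: SG; apply: sub_lspan; left; left.
have Gf : G 1%N f by apply: SG; apply: sub_lspan; left; right.
split; last first.
  have [d d2 dimG0] := hdim0.
  exact: (not_simple_of_nontrivial_module hG (ltnW d2) dimG0 hgen hnontriv).
apply: (indecomposable_of_idempotents hG) => p.
case: hcase => [simpleL|[radL kerL]].
  exact: (idempotent_simple hG Ge hk hef1 simpleL hnonlie).
have [idealL _ _] := (radL (Leib (bracket0 A) (G 1%N))).2 erefl.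
(* Uniqueness of the radical identifies the complement of the Levi factor with Leib. *)
have LJ : Leib (bracket0 A) (G 1%N) = J by apply/radJ/radL.
rewrite -LJ in sumSJ.
apply: (idempotent_semisimple hG Ge Gf hk hef1 hef hhe hhf lieS sumSJ idealL).
move=> a Ga trivial_a.
by have [] : ([set a | D A a = 0] `&` G 0%N) a by rewrite kerL.
Qed.
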